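(* Let $w\in[0,1]$, let $\pi$ be a probability measure on $(0,+\infty)$ with $\int_0^{+\infty}r^{-1}\pi(\mathrm{d}r)<+\infty$, and let $\nu(\mathrm{d}z)=\sigma(z)\,\mathrm{d}z$ be a Lévy measure on $(0,+\infty)$ with $\sigma:(0,+\infty)\to(0,+\infty)$ measurable, $M_1=\int_0^{+\infty}z\,\nu(\mathrm{d}z)\in(0,1)$ and $M_2=\int_0^{+\infty}z^2\,\nu(\mathrm{d}z)<+\infty$. (i) The integro-differential equation $$\frac{\partial}{\partial t}E_t(1,r)=r\left\{-(1-wM_1)E_t(1,r)+(1-w)M_1\int_{y=0}^{y=+\infty}E_t(1,y)\,\pi(\mathrm{d}y)\right\},\quad t>0,\ r>0,$$ subject to the initial condition $E_0(1,\cdot)=1$, admits a unique solution in $\mathbb{L}_T^1$ for any $T>0$, and this solution is continuous with respect to time $t\ge 0$. (ii) With $E_t(1,\cdot)$ the solution in (i), the integro-differential equation $$\frac{\partial}{\partial t}E_t(2,r)=r\left\{-(1-wM_1)E_t(2,r)+(1-w)M_1\int_{y=0}^{y=+\infty}E_t(2,y)\,\pi(\mathrm{d}y)\right\}+rM_2\left\{w\left(E_t(1,r)\right)^2+(1-w)\int_{y=0}^{y=+\infty}\left(E_t(1,y)\right)^2\pi(\mathrm{d}y)\right\},\quad t>0,\ r>0,$$ subject to the initial condition $E_0(2,\cdot)=0$, admits a unique solution in $\mathbb{L}_T^1$ for any $T>0$, and this solution is continuous with respect to time $t\ge 0$.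
   Context: Equations and inequalities for $r>0$ are understood $\pi$-almost everywhere. $\mathbb{L}^1$ is the Lebesgue space of ($\pi$-classes of) measurable functions $\phi:(0,+\infty)\to\mathbb{R}$ with norm $\|\phi\|_1=\int_0^{+\infty}|\phi(r)|\,\pi(\mathrm{d}r)<+\infty$. For $T>0$, $\mathbb{L}_T^1$ is the Banach space of (strongly measurable) functions $\Phi:[0,T]\to\mathbb{L}^1$, $t\mapsto\Phi_t$, with norm $\|\Phi\|_{1,T}=\sup_{0\le t\le T}\|\Phi_t\|_1<+\infty$. Continuity with respect to time means continuity of $t\mapsto\Phi_t$ as a map into $\mathbb{L}^1$. Solutions are understood in the mild (variation-of-constants) sense: for all $t\in[0,T]$ and ($\pi$-a.e.) $r>0$, $$E_t(1,r)=e^{-(1-wM_1)rt}+(1-w)M_1\,r\int_0^t e^{-(1-wM_1)r(t-s)}\left(\int_0^{+\infty}E_s(1,y)\,\pi(\mathrm{d}y)\right)\mathrm{d}s,$$ and, respectively, $$E_t(2,r)=r\int_0^t e^{-(1-wM_1)r(t-s)}\left\{(1-w)M_1\int_0^{+\infty}E_s(2,y)\,\pi(\mathrm{d}y)+M_2\left[w\left(E_s(1,r)\right)^2+(1-w)\int_0^{+\infty}\left(E_s(1,y)\right)^2\pi(\mathrm{d}y)\right]\right\}\mathrm{d}s.$$ *)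

(* Defs.v *)
From HB Require Import structures.
From mathcomp Require Import all_boot all_order all_algebra.
From mathcomp Require Import all_classical all_reals all_analysis.

Set Implicit Arguments.
Unset Strict Implicit.
Unset Printing Implicit Defensive.
Import Order.TTheory GRing.Theory Num.Theory.
Import numFieldNormedType.Exports.

Local Open Scope classical_set_scope.
Local Open Scope ring_scope.

(* Measures on (0, +oo) are Borel measures on R that do not charge ]-oo, 0]. *)

Definition levy_measure (R : realType)
    (nu : {measure set (measurableTypeR R) -> \bar R}) : Prop :=
  nu `]-oo, 0]%classic = 0%E /\
  (\int[nu]_(z in `]0%R, +oo[) (Num.min 1 (z ^+ 2))%:E < +oo)%E.

Definition has_density (R : realType)
    (nu : {measure set (measurableTypeR R) -> \bar R}) (sigma : R -> R) : Prop :=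
  forall A : set (measurableTypeR R), measurable A ->
    nu A = (\int[lebesgue_measure]_(z in A `&` `]0%R, +oo[) (sigma z)%:E)%E.

(* An element of [LspaceType1 P] is a class of integrable functions modulo
   P-a.e. equality; it is evaluated through a fixed representative, so that
   pointwise assertions about it are only meaningful P-almost everywhere. *)

Definition L1norm (R : realType) (P : probability (measurableTypeR R) R)
    (f : LspaceType1 P) : \bar R :=
  Lnorm P 1 (fun r => (f r)%:E).

Definition L1dist (R : realType) (P : probability (measurableTypeR R) R)
    (f g : LspaceType1 P) : \bar R :=
  Lnorm P 1 (fun r => (f r - g r)%:E).

(* Functions on [0, T] are functions on R of which only the values on [0, T]
   matter. *)

Definition simple_on (R : realType) (P : probability (measurableTypeR R) R)
    (T : R) (S : R -> LspaceType1 P) : Prop :=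
  finite_set (S @` `[0, T]) /\
  forall c : LspaceType1 P,
    measurable (`[0, T] `&` S @^-1` [set c] : set (measurableTypeR R)).

Definition strongly_measurable_on (R : realType)
    (P : probability (measurableTypeR R) R) (T : R)
    (Phi : R -> LspaceType1 P) : Prop :=
  exists S : nat -> R -> LspaceType1 P,
    (forall n, simple_on T (S n)) /\
    (forall t, t \in `[0, T] -> L1dist (S n t) (Phi t) @[n --> \oo] --> 0%E).

Definition in_L1T (R : realType) (P : probability (measurableTypeR R) R)
    (T : R) (Phi : R -> LspaceType1 P) : Prop :=
  strongly_measurable_on T Phi /\
  (ereal_sup [set L1norm (Phi t) | t in `[0%R, T]] < +oo)%E.

Definition time_continuous (R : realType)
    (P : probability (measurableTypeR R) R) (Phi : R -> LspaceType1 P) : Prop :=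
  forall t : R, 0 <= t ->
    L1dist (Phi s) (Phi t) @[s --> within `[0, +oo[ (nbhs t)] --> 0%E.

Definition mild_solution1 (R : realType)
    (P : probability (measurableTypeR R) R) (w M1 T : R)
    (E1 : R -> LspaceType1 P) : Prop :=
  forall t, t \in `[0, T] -> {ae P, forall r : R, 0 < r ->
    E1 t r = expR (- (1 - w * M1) * r * t)
      + (1 - w) * M1 * r * \int[lebesgue_measure]_(s in `[0, t])
          (expR (- (1 - w * M1) * r * (t - s))
           * \int[P]_(y in `]0, +oo[) E1 s y)}.

(* For fixed r, the time integral of (E_s(1, r))^2 depends on how the
   representatives of the classes E_s(1, .) are chosen for different s; it is
   meaningful for a representative that is jointly measurable in (s, r), and by
   Fubini's theorem two such representatives give the same value for P-almost
   every r. *)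

Definition measurable_version (R : realType)
    (P : probability (measurableTypeR R) R) (T : R)
    (Phi : R -> LspaceType1 P) (phi : R -> R -> R) : Prop :=
  measurable_fun (`[0, T] `*` setT)
    (fun p : measurableTypeR R * measurableTypeR R => phi p.1 p.2) /\
  forall t, t \in `[0, T] -> {ae P, forall r : R, phi t r = Phi t r}.

Definition mild_solution2 (R : realType)
    (P : probability (measurableTypeR R) R) (w M1 M2 : R)
    (E1 : R -> LspaceType1 P) (T : R) (E2 : R -> LspaceType1 P) : Prop :=
  exists2 e1 : R -> R -> R, measurable_version T E1 e1 &
  forall t, t \in `[0, T] -> {ae P, forall r : R, 0 < r ->
    E2 t r = r * \int[lebesgue_measure]_(s in `[0, t])
      (expR (- (1 - w * M1) * r * (t - s))
       * ((1 - w) * M1 * (\int[P]_(y in `]0, +oo[) E2 s y)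
          + M2 * (w * e1 s r ^+ 2
                  + (1 - w) * \int[P]_(y in `]0, +oo[) (E1 s y ^+ 2))))}.

(* [is_solution T Phi]: Phi solves the equation on [0, T]. *)

Definition solution_for_all_T (R : realType)
    (P : probability (measurableTypeR R) R)
    (is_solution : R -> (R -> LspaceType1 P) -> Prop)
    (Phi : R -> LspaceType1 P) : Prop :=
  forall T : R, 0 < T -> in_L1T T Phi /\ is_solution T Phi.

Definition unique_for_all_T (R : realType)
    (P : probability (measurableTypeR R) R)
    (is_solution : R -> (R -> LspaceType1 P) -> Prop)
    (Phi : R -> LspaceType1 P) : Prop :=
  forall T : R, 0 < T -> forall Psi : R -> LspaceType1 P,
    in_L1T T Psi -> is_solution T Psi ->
    forall t, t \in `[0, T] -> Psi t = Phi t.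

(* Main.v *)
(* With a = 1 - w M1 and b = (1 - w) M1, write V h for the Duhamel term
   (V h)(t, r) = r * int_0^t exp(- a r (t - s)) h(s, r) ds.  Since
   exp(- a r t) = 1 + V(- a)(t, r), both equations read
   E = c + V(q + b * mean E), with c = 1, q = - a for (i), and with c = 0,
   q = M2 (w E(1)^2 + (1 - w) mean(E(1)^2)) for (ii).  The factor r is absorbed
   by r * int_0^t exp(- a r (t - s)) ds <= 1 / a, so |V h| <= sup |h| / a, and
   m |-> mean (c + V(q + b m)) contracts the sup norm with ratio b / a < 1.
   Its fixed point gives a bounded jointly measurable solution, continuous in t
   for fixed r, hence continuous in L^1 by dominated convergence; the same
   contraction applied to the means gives uniqueness. *)
Require Import Defs.
From HB Require Import structures.
From mathcomp Require Import all_boot all_order all_algebra.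
From mathcomp Require Import all_classical all_reals all_analysis.
From mathcomp Require Import measurable_realfun ring lra.

Set Implicit Arguments.
Unset Strict Implicit.
Unset Printing Implicit Defensive.
Import Order.TTheory GRing.Theory Num.Theory.
Import numFieldNormedType.Exports.

Local Open Scope classical_set_scope.
Local Open Scope ring_scope.

(** * The Duhamel operator *)

Lemma bounded_integrable d (T : measurableType d) (R : realType)
    (mu : {measure set T -> \bar R}) (A : set T) (C : R) (f : T -> R) :
  measurable A -> (mu A < +oo)%E -> measurable_fun A f ->
  (forall x, A x -> `|f x| <= C) -> mu.-integrable A (EFin \o f).
Proof.
move=> mA Afin mf fC; apply: measurable_bounded_integrable => //.
exists C; split; [exact: num_real|move=> M CM x Ax].
by apply: (le_trans (fC x Ax)); exact: ltW.
Qed.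

(** The primitive in s is u^-1 exp(- u (t - s)). Taken at u = a r, the factor [u^-1] is what cancels
    the unbounded weight r in [duhamel_le]. The fundamental theorem is applied on a nondegenerate
    interval, hence the separate case t = 0. *)
Lemma Rintegral_expR_decay (R : realType) (u t : R) : 0 < u -> 0 <= t ->
  \int[lebesgue_measure]_(s in `[0, t]) expR (- u * (t - s)) =
  u^-1 * (1 - expR (- u * t)).
Proof.
move=> u0; rewrite le_eqVlt => /predU1P[<-|t0].
  by rewrite set_itv1 Rintegral_set1 mulr0 expR0 subrr mulr0.
rewrite /Rintegral.
have cE : continuous (fun s => expR (- u * (t - s)) : R).
  move=> x; apply: continuous_comp; last exact: continuous_expR.
  apply: continuousM; first exact: cst_continuous.
  by apply: continuousB; [exact: cst_continuous|].
have dF (x : R) : is_derive x (1 : R)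
    (fun s => u^-1 * expR (- u * (t - s))) (expR (- u * (t - x))).
  apply: is_derive_eq; rewrite /GRing.scale /=.
  by field; rewrite gt_eqF.
have cF : continuous (fun s => u^-1 * expR (- u * (t - s)) : R).
  by move=> x; apply: cvgM; [exact: cvg_cst|exact: cE].
rewrite (@continuous_FTC2 _ _ (fun s => u^-1 * expR (- u * (t - s)))) //.
- by rewrite subrr mulr0 expR0 subr0 -EFinB /= mulr1 mulrBr mulr1.
- exact: continuous_subspaceT.
- split.
  + by move=> x _; apply: ex_derive.
  + by apply/cvg_at_right_filter; exact: cF.
  + by apply/cvg_at_left_filter; exact: cF.
- by move=> x _; rewrite derive1E; apply: derive_val.
Qed.

(** Tonelli applies to the positive and negative parts separately. Since [fine] is measurable on the
    whole extended line, sections with an infinite integral cause no trouble. *)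
Lemma measurable_fun_Rintegral d1 d2 (T1 : measurableType d1)
    (T2 : measurableType d2) (R : realType)
    (m2 : {sigma_finite_measure set T2 -> \bar R}) (g : T1 * T2 -> R) :
  measurable_fun [set: T1 * T2] g ->
  measurable_fun [set: T1] (fun x => \int[m2]_y g (x, y)).
Proof.
move=> /measurable_EFinP mg.
have FE : (fun x => \int[m2]_y g (x, y)) =
    fine \o (fubini_F m2 (EFin \o g)^\+%E \- fubini_F m2 (EFin \o g)^\-%E)%E.
  apply/funext => x; rewrite /Rintegral integralE /=; congr (fine (_ - _)%E);
    rewrite /fubini_F; apply: eq_integral => y _.
  - by rewrite !funeposE.
  - by rewrite !funenegE.
rewrite FE; apply: measurableT_comp => //; apply: emeasurable_funB.
- by apply: measurable_fun_fubini_tonelli_F => //; exact: measurable_funepos.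
- by apply: measurable_fun_fubini_tonelli_F => //; exact: measurable_funeneg.
Qed.

(* The clamp at r = 0 makes the bound [duhamel_le] and the joint measurability
   hold on all of R * R; for t < 0 the integral is over the empty set. *)
Definition duhamel (R : realType) (a : R) (h : R -> R -> R) (t r : R) : R :=
  Num.max r 0 * \int[lebesgue_measure]_(s in `[0, t])
    (expR (- a * Num.max r 0 * (t - s)) * h s r).

Definition measurable2 (R : realType) (h : R -> R -> R) :=
  measurable_fun [set: measurableTypeR R * measurableTypeR R]
    (fun p => h p.1 p.2).

(** The bound is pointwise and covers negative times and positions, so that estimates on a slice in
    s and on a row in r come without side conditions or null sets. *)
Definition bounded_measurable2 (R : realType) (C : R) (h : R -> R -> R) :=
  measurable2 h /\ forall s r, `|h s r| <= C.

Lemma measurable2_slice (R : realType) (h : R -> R -> R) (r : R) :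
  measurable2 h -> measurable_fun [set: measurableTypeR R] (h ^~ r).
Proof.
move=> mh; exact: (measurableT_comp mh (measurable_pair2 r)).
Qed.

Lemma measurable_expR_affine (R : realType) (u v : R)
    (A : set (measurableTypeR R)) :
  measurable_fun A (fun s => expR (u * (v - s))).
Proof.
apply: measurable_funTS; apply: measurableT_comp => //.
by apply: measurable_funM => //; apply: measurable_funB.
Qed.

(** The clamp keeps the exponent nonpositive for s in [0, t], so the kernel is at most 1 and the
    integrand at most [C] in absolute value. *)
Lemma duhamel_integrable (R : realType) (a C : R) (h : R -> R -> R) (t r : R) :
  0 < a -> bounded_measurable2 C h ->
  lebesgue_measure.-integrable `[0, t]
    (EFin \o (fun s => expR (- a * Num.max r 0 * (t - s)) * h s r)).
Proof.
move=> a0 [mh hC]; apply: (@bounded_integrable _ _ _ _ _ C) => //.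
- by rewrite /= lebesgue_measure_itv /=; case: ifPn => _; rewrite ?ltry // -EFinB ltry.
- apply: measurable_funM; first exact: measurable_expR_affine.
  by apply: measurable_funTS; exact: measurable2_slice.
- move=> s /=; rewrite in_itv /= => /andP[s0 st].
  rewrite normrM -[leRHS]mul1r ler_pM // ger0_norm ?expR_ge0 // -expR0 ler_expR.
  by rewrite -mulrA mulNr oppr_le0 !mulr_ge0 ?subr_ge0 ?le_max ?lexx ?orbT // ltW.
Qed.

Lemma duhamel_le (R : realType) (a C : R) (h : R -> R -> R) (t r : R) :
  0 < a -> bounded_measurable2 C h -> `|duhamel a h t r| <= C / a.
Proof.
move=> a0 hb; have [mh hC] := hb.
have C0 : 0 <= C by apply: le_trans (hC 0 0).
rewrite /duhamel normrM.
have [r0|r0] := leP r 0; first by rewrite normr0 mul0r divr_ge0 // ltW.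
have [t0|t0] := ltP t 0.
  by rewrite set_itv_ge ?Rintegral_set0 ?normr0 ?mulr0 ?divr_ge0 ?(ltW a0)// bnd_simp -ltNge.
have u0 : 0 < a * r by rewrite mulr_gt0.
rewrite gtr0_norm //.
(* The majorant is the integrand of the Duhamel term with constant source [C]. *)
have iE : lebesgue_measure.-integrable `[0, t]
    (EFin \o (fun s : R => expR (- (a * r) * (t - s)) * C)).
  have := @duhamel_integrable R a C (fun _ _ => C) t r a0.
  rewrite max_l ?(ltW r0) // mulNr; apply.
  by split => [|s x]; [exact: measurable_cst|rewrite ger0_norm].
apply: (@le_trans _ _ (r *
  \int[lebesgue_measure]_(s in `[0, t]) (expR (- (a * r) * (t - s)) * C))).
  rewrite ler_pM2l //.
  apply: le_trans; first apply: le_normr_Rintegral => //.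
    by have := @duhamel_integrable R a C h t r a0 hb; rewrite max_l ?(ltW r0).
  apply: le_Rintegral => //.
    have := @duhamel_integrable R a C (fun s r => `|h s r|) t r a0.
    rewrite max_l ?(ltW r0) // => /(_ _)/= H.
    apply: eq_integrable (H _) => //.
      by move=> s _ /=; rewrite normrM (ger0_norm (expR_ge0 _)).
    by split => [|s x]; [exact: measurableT_comp mh|rewrite normr_id].
  move=> s _; rewrite normrM (ger0_norm (expR_ge0 _)) mulNr.
  by rewrite ler_wpM2l // expR_ge0.
rewrite RintegralZr //.
  (* Here r cancels against (a r)^-1, and 1 - exp(- a r t) is at most 1. *)
  rewrite Rintegral_expR_decay // invfM mulrA [r * _]mulrA (mulrC a^-1).
  rewrite (mulrA r) divff ?gt_eqF // mul1r.
  rewrite mulrC ler_wpM2l // ler_piMr ?invr_ge0 ?(ltW a0) // lerBlDr lerDl expR_ge0.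
have := @duhamel_integrable R a 1 (fun _ _ => 1) t r a0.
rewrite max_l ?(ltW r0) // => H.
apply: eq_integrable (H _) => //.
  by move=> s _ /=; rewrite mulr1 mulNr.
by split => [|s x]; [exact: measurable_cst|rewrite normr1].
Qed.

Lemma duhamelB (R : realType) (a C1 C2 : R) (h1 h2 : R -> R -> R) (t r : R) :
  0 < a -> bounded_measurable2 C1 h1 -> bounded_measurable2 C2 h2 ->
  duhamel a (fun s r => h1 s r - h2 s r) t r = duhamel a h1 t r - duhamel a h2 t r.
Proof.
move=> a0 b1 b2; rewrite /duhamel -mulrBr -RintegralB //.
- by congr (_ * _); apply: eq_Rintegral => s _; rewrite mulrBr.
- exact: duhamel_integrable b1.
- exact: duhamel_integrable b2.
Qed.

(** Causality of the Duhamel term. It allows a source controlled only on [0, T] to be replaced by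
    one that is bounded and measurable at all times. *)
Lemma eq_duhamel (R : realType) (a : R) (h1 h2 : R -> R -> R) (t r : R) :
  (forall s, 0 <= s <= t -> h1 s r = h2 s r) ->
  duhamel a h1 t r = duhamel a h2 t r.
Proof.
move=> h12; congr (_ * _); apply: eq_Rintegral => s.
by rewrite inE /= in_itv /= => /h12 ->.
Qed.

(** At k = a this is 1 - exp(- a r t), which ties the free term of equation (i) to a constant
    source. *)
Lemma duhamel_cst (R : realType) (a k t r : R) : 0 < a -> 0 <= t -> 0 < r ->
  duhamel a (fun _ _ => k) t r = k / a * (1 - expR (- a * r * t)).
Proof.
move=> a0 t0 r0; rewrite /duhamel max_l ?(ltW r0) // RintegralZr //.
  rewrite mulNr Rintegral_expR_decay ?mulr_gt0 //.
  by field; rewrite !gt_eqF.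
have := @duhamel_integrable R a 1 (fun _ _ => 1) t r a0.
rewrite max_l ?(ltW r0) // => H.
apply: eq_integrable (H _) => //.
  by move=> s _ /=; rewrite mulr1.
by split => [|s x]; [exact: measurable_cst|rewrite normr1].
Qed.

Lemma measurable_duhamel (R : realType) (a C : R) (h : R -> R -> R) :
  0 < a -> bounded_measurable2 C h -> measurable2 (duhamel a h).
Proof.
move=> a0 [mh hC].
pose T3 := ((measurableTypeR R * measurableTypeR R) * measurableTypeR R)%type.
(* With z = ((t, r), s), the moving domain [0, t] becomes an indicator, so that the integral runs
   over a fixed space and Tonelli applies. *)
pose g (z : T3) : R :=
  ((0 <= z.2) && (z.2 <= z.1.1))%:R *
    (expR (- a * Num.max z.1.2 0 * (z.1.1 - z.2)) * h z.2 z.1.2).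
have mmax : measurable_fun [set: T3] (fun z => Num.max z.1.2 0 : R).
  apply: measurable_maxr => //.
  exact: (measurableT_comp measurable_snd measurable_fst).
have m11 : measurable_fun [set: T3] (fun z => z.1.1).
  exact: (measurableT_comp measurable_fst measurable_fst).
have mg : measurable_fun setT g.
  apply: measurable_funM.
    apply: measurableT_comp => //.
    by apply: measurable_and; apply: measurable_fun_ler.
  apply: measurable_funM.
    apply: measurableT_comp => //; apply: measurable_funM.
      exact: measurable_funM.
    exact: measurable_funB.
  apply: (measurableT_comp mh
    (_ : measurable_fun setT (fun z : T3 => (z.2, z.1.2)))).
  apply: measurable_fun_pair => //.
  exact: (measurableT_comp measurable_snd measurable_fst).
have mG : measurable_fun setT (fun p : measurableTypeR R * measurableTypeR R =>
   \int[@lebesgue_measure R]_s g (p, s)).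
  exact: (measurable_fun_Rintegral (@lebesgue_measure R) mg).
rewrite /measurable2 /duhamel; apply: measurable_funM.
  by apply: measurable_maxr.
apply: eq_measurable_fun mG => -[t r] _ /=.
rewrite [RHS]Rintegral_mkcond; apply: eq_Rintegral => s _.
rewrite patchE /g /= mem_setE in_itv /=.
by case: ifPn => _; rewrite ?mul1r ?mul0r.
Qed.

Lemma continuous_duhamel (R : realType) (a C : R) (h : R -> R -> R) (r : R) :
  0 < a -> bounded_measurable2 C h -> continuous (duhamel a h ^~ r).
Proof.
move=> a0 [mh hC] t0; pose u := a * Num.max r 0.
pose A := `|t0| + 1.
have u0 : 0 <= u by rewrite mulr_ge0 ?(ltW a0) // le_max lexx orbT.
have A0 : 0 < A by rewrite ltr_wpDl.
(* exp(- u (t - s)) factors as exp(- u t) exp(u s), so t only enters the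
   integral through its upper bound. *)
pose g (s : R) := expR (u * s) * h s r.
(* Cutting [g] off below 0 lets every integral start at [- A]. The choice of [A] puts t0, of either
   sign, in the interior of [- A, A]; for t < 0 both forms of the integral vanish. *)
pose g0 := g \_ `[0, +oo[.
have ig : lebesgue_measure.-integrable `[- A, A] (EFin \o g0).
  apply: (@bounded_integrable _ _ _ _ _ (expR (u * A) * C)) => //.
  - by rewrite /= lebesgue_measure_itv /=; case: ifPn => _; rewrite ?ltry // -EFinB ltry.
  - apply: measurable_funTS; apply/measurable_restrict => //.
    apply: measurable_funTS; apply: measurable_funM.
      by apply: measurableT_comp => //; apply: measurable_funM.
    exact: measurable2_slice.
  - move=> s /=; rewrite in_itv /= => /andP[_ sA].
    rewrite /g0 patchE; case: ifPn => _; last first.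
      by rewrite normr0 mulr_ge0 ?expR_ge0 // (le_trans _ (hC 0 0)).
    rewrite normrM ler_pM // (ger0_norm (expR_ge0 _)) ler_expR.
    exact: ler_wpM2l.
have cG : {for t0,
    continuous (fun t : R => \int[lebesgue_measure]_(s in `[- A, t]) g0 s)}.
  have AA : - A < A by lra.
  have [+ _ _] := (continuous_within_itvP _ AA).1
    (parameterized_integral_continuous (ltW AA) ig).
  apply; rewrite in_itv /= -ltr_norml /A.
  by rewrite ltrDl.
have -> : duhamel a h ^~ r = (fun t => Num.max r 0 *
    (expR (- u * t) * \int[lebesgue_measure]_(s in `[- A, t]) g0 s)).
  apply/funext => t; rewrite /duhamel; congr (_ * _).
  rewrite -Rintegral_mkcondr.
  have -> : [set` `[- A, t]] `&` [set` `[0, +oo[] = [set` `[0, t]] :> set R.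
    apply/seteqP; split => s /=; rewrite !in_itv /= andbT.
      by case=> /andP[_ ->] ->.
    by move=> /andP[s0 ->]; rewrite s0 (le_trans _ s0) // oppr_le0 ltW.
  have -> : \int[lebesgue_measure]_(s in `[0, t]) g s = expR (u * t) *
      \int[lebesgue_measure]_(s in `[0, t])
        (expR (- a * Num.max r 0 * (t - s)) * h s r).
    rewrite -RintegralZl //; last exact: (@duhamel_integrable R a C).
    apply: eq_Rintegral => s _; rewrite /g mulrA -expRD; congr (expR _ * _).
    by rewrite /u; ring.
  by rewrite [RHS]mulrA -expRD -mulrDl addNr mul0r expR0 mul1r.
apply: cvgM; first exact: cvg_cst.
apply: cvgM; last exact: cG.
apply: continuous_comp; last exact: continuous_expR.
by apply: cvgM; [exact: cvg_cst|].
Qed.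

(** * Means and the fixed point *)

Definition prob_mean (R : realType) (P : probability (measurableTypeR R) R)
    (e : R -> R -> R) (t : R) : R :=
  \int[P]_(y in `]0, +oo[) e t y.

Lemma prob_lty (R : realType)
    (P : probability (measurableTypeR R) R)
  (A : set (measurableTypeR R)) : measurable A -> (P A < +oo)%E.
Proof.
by move=> mA; rewrite ltey_eq fin_num_measure.
Qed.

Lemma measurable2_row (R : realType) (h : R -> R -> R) (t : R) :
  measurable2 h -> measurable_fun [set: measurableTypeR R] (h t).
Proof.
move=> mh; exact: (measurableT_comp mh (measurable_pair1 t)).
Qed.

Lemma row_integrable (R : realType)
    (P : probability (measurableTypeR R) R)
    (C : R) (e : R -> R -> R) (t : R) (A : set (measurableTypeR R)) :
  measurable A -> bounded_measurable2 C e -> P.-integrable A (EFin \o e t).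
Proof.
move=> mA [me eC]; apply: (@bounded_integrable _ _ _ _ _ C) => //.
  exact: prob_lty.
by apply: measurable_funTS; exact: measurable2_row.
Qed.

Lemma measurable_prob_mean (R : realType)
    (P : probability (measurableTypeR R) R)
    (C : R) (e : R -> R -> R) :
  bounded_measurable2 C e ->
  measurable_fun [set: measurableTypeR R] (prob_mean P e).
Proof.
move=> [me eC].
pose g : measurableTypeR R * measurableTypeR R -> R :=
  fun p => e p.1 p.2 * \1_(`]0%R, +oo[%classic) p.2.
have mg : measurable_fun setT g.
  apply: measurable_funM => //.
  by apply: measurableT_comp => //; exact: measurable_indic.
have -> : prob_mean P e = fun t => \int[P]_y g (t, y).
  apply/funext => t; rewrite /prob_mean Rintegral_mkcond.
  apply: eq_Rintegral => y _.
  by rewrite /g patchE indicE; case: ifPn => _; rewrite ?mulr1 ?mulr0.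
exact: measurable_fun_Rintegral mg.
Qed.

Lemma normr_Rintegral_le (R : realType)
    (P : probability (measurableTypeR R) R)
    (C : R) (f : R -> R) (A : set (measurableTypeR R)) :
  measurable A -> 0 <= C -> P.-integrable A (EFin \o f) ->
  {ae P, forall r, A r -> `|f r| <= C} -> `|\int[P]_(y in A) f y| <= C.
Proof.
move=> mA C0 intf fC.
have /integrableP[mf _] := intf.
rewrite -lee_fin EFin_normr_Rintegral //.
apply: (le_trans (le_abse_integral P mA mf)).
have := @integral_le_bound _ _ _ P A (EFin \o f) C%:E mA mf.
rewrite lee_fin => /(_ C0) H; apply: le_trans (H _) _ => //.
by rewrite -[leRHS]mule1 lee_wpmul2l ?lee_fin // probability_le1.
Qed.

Lemma prob_mean_dist (R : realType)
    (P : probability (measurableTypeR R) R)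
    (C1 C2 D : R) (e1 e2 : R -> R -> R) (t : R) :
  bounded_measurable2 C1 e1 -> bounded_measurable2 C2 e2 -> 0 <= D ->
  (forall r, `|e1 t r - e2 t r| <= D) ->
  `|prob_mean P e1 t - prob_mean P e2 t| <= D.
Proof.
move=> b1 b2 D0 e12; rewrite /prob_mean -RintegralB //.
- apply: normr_Rintegral_le => //; last by apply: aeW.
  apply: (@bounded_integrable _ _ _ _ _ D) => //; first exact: prob_lty.
  case: b1 b2 => [m1 _] [m2 _].
  by apply: measurable_funTS; apply: measurable_funB; exact: measurable2_row.
- exact: row_integrable b1.
- exact: row_integrable b2.
Qed.

Lemma prob_mean_le (R : realType)
    (P : probability (measurableTypeR R) R)
    (C : R) (e : R -> R -> R) (t : R) :
  bounded_measurable2 C e -> `|prob_mean P e t| <= C.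
Proof.
move=> b; apply: normr_Rintegral_le => //.
- by case: b => _ /(_ 0 0); apply: le_trans.
- exact: row_integrable b.
- by apply: aeW => r _; case: b.
Qed.

(** The bound tends to 0 with n. This is how contractions are exploited below: n iterations bound a
    distance by q^n times a fixed constant. *)
Lemma geometric_bound_eq0 (R : realType) (q K x : R) : 0 <= q < 1 ->
  (forall n, `|x| <= q ^+ n * K) -> x = 0.
Proof.
move=> /andP[q0 q1] xq; apply/eqP; rewrite -normr_eq0 eq_le normr_ge0 andbT.
have cq : (fun n => q ^+ n * K : R) @ \oo --> (0 * K : R).
  by apply: cvgMl; apply: cvg_expr; rewrite ger0_norm.
rewrite mul0r in cq.
by apply: (cvgr_to_ge cq); apply: nearW => n.
Qed.

(** * The mild equation and its contraction property *)

Definition mild_step (R : realType) (a b c : R) (q : R -> R -> R) (m : R -> R)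
    (t r : R) : R :=
  c + duhamel a (fun s r => q s r + b * m s) t r.

Lemma bounded_source (R : realType) (b Q K : R) (q : R -> R -> R) (m : R -> R) :
  0 <= b -> bounded_measurable2 Q q ->
  measurable_fun [set: measurableTypeR R] m -> (forall s, `|m s| <= K) ->
  bounded_measurable2 (Q + b * K) (fun s r => q s r + b * m s).
Proof.
move=> b0 [mq qQ] mm mK; split => [|s r].
  apply: measurable_funD => //; apply: measurable_funM => //.
  exact: (measurableT_comp mm measurable_fst).
apply: (le_trans (ler_normD _ _)); apply: lerD => //.
by rewrite normrM (ger0_norm b0) ler_wpM2l.
Qed.

Lemma bounded_mild_step (R : realType) (a b c Q K : R) (q : R -> R -> R)
    (m : R -> R) :
  0 < a -> 0 <= b -> bounded_measurable2 Q q ->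
  measurable_fun [set: measurableTypeR R] m -> (forall s, `|m s| <= K) ->
  bounded_measurable2 (`|c| + (Q + b * K) / a) (mild_step a b c q m).
Proof.
move=> a0 b0 bq mm mK; have bs := bounded_source b0 bq mm mK; split => [|t r].
  apply: measurable_funD => //; exact: measurable_duhamel a0 bs.
apply: (le_trans (ler_normD _ _)); rewrite lerD2l.
exact: duhamel_le.
Qed.

(** The constant and the source [q] cancel, leaving the Duhamel term of b (m1 - m2), which
    [duhamel_le] bounds by b D / a. Closeness is asked on [0, t] only, because in the uniqueness
    proof it is known only up to time T. *)
Lemma mild_step_dist (R : realType) (a b c Q K1 K2 D t r : R)
    (q : R -> R -> R) (m1 m2 : R -> R) :
  0 < a -> 0 <= b -> bounded_measurable2 Q q ->
  measurable_fun [set: measurableTypeR R] m1 -> (forall s, `|m1 s| <= K1) ->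
  measurable_fun [set: measurableTypeR R] m2 -> (forall s, `|m2 s| <= K2) ->
  0 <= D -> (forall s, 0 <= s <= t -> `|m1 s - m2 s| <= D) ->
  `|mild_step a b c q m1 t r - mild_step a b c q m2 t r| <= b / a * D.
Proof.
move=> a0 b0 bq mm1 mK1 mm2 mK2 D0 m12.
rewrite /mild_step opprD addrACA subrr add0r.
rewrite -(duhamelB t r a0 (bounded_source b0 bq mm1 mK1)
  (bounded_source b0 bq mm2 mK2)).
(* [duhamel_le] wants a bound at all times, so the difference is set to 0 outside [0, t]. *)
pose d (s : R) := ((fun s => b * (m1 s - m2 s)) \_ `[0, t]) s.
rewrite (@eq_duhamel _ _ _ (fun s _ => d s)); last first.
  move=> s st; rewrite /d patchE mem_set; last by rewrite /= in_itv.
  by rewrite mulrBr opprD addrACA subrr add0r.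
rewrite mulrAC; apply: duhamel_le => //; split => [|s x].
  apply: (measurableT_comp (_ : measurable_fun setT d) measurable_fst).
  apply/measurable_restrict => //; apply: measurable_funTS.
  by apply: measurable_funM => //; exact: measurable_funB.
rewrite /d patchE; case: ifPn => [|_]; last by rewrite normr0 mulr_ge0.
by rewrite inE /= in_itv /= => st; rewrite normrM (ger0_norm b0) ler_wpM2l // m12.
Qed.

(** The unknown enters the right-hand side only through its mean, so Picard iteration is run on
    functions of time alone and [e] is recovered at the end by one application of [mild_step]. *)
Lemma mild_equation_exists (R : realType)
    (P : probability (measurableTypeR R) R)
    (a b c Q : R) (q : R -> R -> R) :
  0 <= b < a -> bounded_measurable2 Q q ->
  exists C : R, exists2 e : R -> R -> R, bounded_measurable2 C e &
    forall t r, e t r = mild_step a b c q (prob_mean P e) t r.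
Proof.
move=> /andP[b0 ba] bq.
have a0 : 0 < a by apply: le_lt_trans ba.
have Q0 : 0 <= Q by case: bq => _ /(_ 0 0); apply: le_trans.
pose k := b / a.
have k0 : 0 <= k by rewrite divr_ge0 // ltW.
have k1 : k < 1 by rewrite ltr_pdivrMr // mul1r.
(* [K] solves |c| + (Q + b K) / a = K: the ball of radius [K] is mapped into itself. *)
pose K := (`|c| + Q / a) / (1 - k).
have K0 : 0 <= K.
  apply: divr_ge0; last by rewrite subr_ge0 ltW.
  by rewrite addr_ge0 // divr_ge0 // ltW.
have KE : `|c| + (Q + b * K) / a = K.
  by rewrite /K /k; field; rewrite !gt_eqF //= subr_gt0.
pose F m := mild_step a b c q m.
pose u := fix u n := if n is n'.+1 then prob_mean P (F (u n')) else fun=> 0.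
have uP n : measurable_fun [set: measurableTypeR R] (u n) /\
    forall s, `|u n s| <= K.
  elim: n => [|n [mu uK]].
    by split => [|s]; [exact: measurable_cst|rewrite normr0].
  have := @bounded_mild_step _ a b c Q K q (u n) a0 b0 bq mu uK.
  rewrite KE => bF; split; first exact: measurable_prob_mean bF.
  by move=> s; exact: prob_mean_le bF.
have contr (m1 m2 : R -> R) (D t : R) :
    measurable_fun [set: measurableTypeR R] m1 ->
    (forall s, `|m1 s| <= K) ->
    measurable_fun [set: measurableTypeR R] m2 -> (forall s, `|m2 s| <= K) ->
    0 <= D -> (forall s, `|m1 s - m2 s| <= D) ->
    `|prob_mean P (F m1) t - prob_mean P (F m2) t| <= k * D.
  move=> mm1 mK1 mm2 mK2 D0 m12; apply: prob_mean_dist.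
  - exact: (@bounded_mild_step _ _ _ _ _ _ _ _ a0 b0 bq mm1 mK1).
  - exact: (@bounded_mild_step _ _ _ _ _ _ _ _ a0 b0 bq mm2 mK2).
  - by rewrite mulr_ge0.
  - by move=> r; apply: (mild_step_dist _ _ a0 b0 bq mm1 mK1 mm2 mK2 D0).
(* Both indices are shifted together, so n contractions reduce the claim to the distance from [u p]
   to [u 0] = 0, which is at most [K]; no geometric series has to be summed. *)
have ucauchy n p t : `|u (n + p)%N t - u n t| <= k ^+ n * K.
  elim: n t => [|n IH] t; first by rewrite add0n subr0 expr0 mul1r; case: (uP p).
  rewrite exprS -mulrA; have [? ?] := uP n; have [? ?] := uP (n + p)%N.
  by apply: contr => //; rewrite mulr_ge0 // exprn_ge0.
have kK : (fun n => k ^+ n * K : R) @ \oo --> (0 : R).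
  rewrite -[X in _ --> X](mul0r K).
  by apply: cvgMl; apply: cvg_expr; rewrite ger0_norm.
have ucvg t : cvgn (fun n => u n t).
  apply/cauchy_cvgP/cauchy_exP => e e0.
  have /cvgrPdist_lt/(_ e e0)[n _ kn] := kK.
  exists (u n t); exists n => // p /= np.
  rewrite /ball /= distrC -(subnKC np).
  apply: (le_lt_trans (ucauchy _ _ _)).
  by have := kn n (leqnn n); rewrite sub0r normrN ger0_norm // mulr_ge0 ?exprn_ge0.
pose m (t : R) : R := limn (fun n => u n t).
(* Limit p to infinity in [ucauchy]. *)
have um n t : `|m t - u n t| <= k ^+ n * K.
  have : (fun p => `|u (n + p)%N t - u n t|) @ \oo --> `|m t - u n t|.
    apply: cvg_norm; apply: cvgB; last exact: cvg_cst.
    have -> : (fun p => u (n + p)%N t) = [sequence (u ^~ t) (p + n)%N]_p.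
      by apply/funext => p /=; rewrite addnC.
    have cm : u ^~ t @ \oo --> m t := ucvg t.
    by move: cm; rewrite -(cvg_shiftn n).
  by move=> /cvgr_to_le; apply; apply: nearW => p; exact: ucauchy.
have mm : measurable_fun [set: measurableTypeR R] m.
  apply: (measurable_fun_cvg (fun n => (uP n).1)).
  by move=> t _; exact: ucvg.
have mK s : `|m s| <= K by have := um 0 s; rewrite expr0 mul1r subr0.
(* The mean of [F (u n)] is [u n.+1], which is inserted between the two sides; each of the two
   distances is at most k^n K. *)
have mE t : prob_mean P (F m) t = m t.
  apply/eqP; rewrite -subr_eq0; apply/eqP.
  apply: (@geometric_bound_eq0 _ k (K + K)); first by rewrite k0.
  move=> n; rewrite mulrDr.
  have D0 : 0 <= k ^+ n * K by rewrite mulr_ge0 // exprn_ge0.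
  rewrite -(subrK (prob_mean P (F (u n)) t) (prob_mean P (F m) t)) -addrA.
  apply: (le_trans (ler_normD _ _)); apply: lerD.
    have [? ?] := uP n.
    apply: (@le_trans _ _ (k * (k ^+ n * K))); first by apply: contr.
    by rewrite ler_piMl // ltW.
  rewrite distrC; apply: (le_trans (um n.+1 t)).
  by rewrite exprS -mulrA ler_piMl // ltW.
(* The mean of [F m] is [m], hence [F m] satisfies the equation at every t and r, and not merely
   almost everywhere. *)
exists K, (F m).
  by have := bounded_mild_step c a0 b0 bq mm mK; rewrite KE.
have -> : prob_mean P (F m) = m by apply/funext => s; exact: mE.
by [].
Qed.

(** * Paths in L^1 *)

Lemma ae_mono (R : realType) (mu : {measure set (measurableTypeR R) -> \bar R})
    (A B : R -> Prop) : (forall r, A r -> B r) ->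
  {ae mu, forall r : R, A r} -> {ae mu, forall r : R, B r}.
Proof.
by move=> AB; apply: (@filterS _ _ (ae_filter_ringOfSetsType mu)).
Qed.

Lemma ae_mono2 (R : realType) (mu : {measure set (measurableTypeR R) -> \bar R})
    (A B C : R -> Prop) : (forall r, A r -> B r -> C r) ->
  {ae mu, forall r : R, A r} -> {ae mu, forall r : R, B r} ->
  {ae mu, forall r : R, C r}.
Proof.
by move=> ABC; apply: (@filterS2 _ _ (ae_filter_ringOfSetsType mu)).
Qed.

Lemma ae_gt0 (R : realType) (P : probability (measurableTypeR R) R) :
  P `]0, +oo[%classic = 1%E -> {ae P, forall r : R, 0 < r}.
Proof.
move=> P1; exists (~` [set` `]0, +oo[]); split.
- exact: measurableC.
- by rewrite probability_setC // P1 subee.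
- by apply: subsetC => r /=; rewrite in_itv /= andbT.
Qed.

(** An element of [LspaceType1 P] is a quotient class with a proof that its norm is finite. Almost
    everywhere equal representatives have the same class, and proof irrelevance identifies the
    rest. *)
Lemma Lspace1_ext (R : realType)
    (P : probability (measurableTypeR R) R)
    (f g : LspaceType1 P) : {ae P, forall r, f r = g r} -> f = g.
Proof.
move=> fg.
have : (f : aeEqMfun _ _) = g :> aeEqMfun _ _.
  rewrite -[LHS]reprK -[RHS]reprK; apply/eqmodP; apply/asboolP.
  by apply: filterS fg => r + _.
case: f g {fg} => [f [[pf]]] [g [[pg]]] /= fg; move: pf pg; rewrite fg => pf pg.
by rewrite (Prop_irrelevance pf pg).
Qed.

Lemma Lspace1_measurable (R : realType)
    (P : probability (measurableTypeR R) R)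
    (f : LspaceType1 P) : measurable_fun [set: measurableTypeR R] f.
Proof.
exact: (measurable_funP (repr (f : aeEqMfun _ P))).
Qed.

Lemma Lspace1_integrable (R : realType)
    (P : probability (measurableTypeR R) R)
    (f : LspaceType1 P) : P.-integrable setT (EFin \o f).
Proof.
apply/integrableP; split; first by apply/measurable_EFinP; exact: Lspace1_measurable.
have : finite_norm P 1 f by exact: Lebesgue_finite.
by rewrite /finite_norm Lnorm1.
Qed.

(** The witness is the class of f. The representative that the quotient picks in it agrees with f
    only almost everywhere. *)
Lemma Lspace1_lift (R : realType)
    (P : probability (measurableTypeR R) R)
    (f : R -> R) : P.-integrable setT (EFin \o f) ->
  exists g : LspaceType1 P, {ae P, forall r, g r = f r}.
Proof.
move=> /integrableP[/measurable_EFinP mf fy].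
pose F : {mfun measurableTypeR R >-> measurableTypeR R} :=
  HB.pack f (isMeasurableFun.Build _ _
    (measurableTypeR R) (measurableTypeR R) f mf).
pose cF : aeEqMfun _ P := (\pi F)%qT.
have cFE : {ae P, forall r, cF r = f r}.
  have /eqmodP/asboolP : (\pi_(aeEqMfun _ P) (repr cF) = \pi F)%qT by rewrite reprK.
  by apply: filterS => r /(_ I).
have fin : finite_norm P 1 cF.
  rewrite /finite_norm Lnorm1.
  rewrite (@ae_eq_integral _ _ _ P setT (fun r => `|(f r)%:E|)%E) //.
  - apply: measurableT_comp => //; apply/measurable_EFinP.
    exact: (measurable_funP (repr cF)).
  - by apply: measurableT_comp => //; exact/measurable_EFinP.
  - by apply: filterS cFE => r /= ->.
pose g : LspaceType1 P :=
  HB.pack cF (isFinLebesgue.Build _ _ _ P 1%E (lexx _) cF fin).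
by exists g.
Qed.

Lemma L1distE (R : realType)
    (P : probability (measurableTypeR R) R)
    (f g : LspaceType1 P) (f' g' : R -> R) :
  P.-integrable setT (EFin \o f') -> P.-integrable setT (EFin \o g') ->
  {ae P, forall r, f r = f' r} -> {ae P, forall r, g r = g' r} ->
  L1dist f g = (\int[P]_r `|f' r - g' r|)%:E.
Proof.
move=> if' ig' ff' gg'.
have mf : measurable_fun [set: measurableTypeR R] (fun r => `|f r - g r|).
  apply: measurableT_comp => //.
  by apply: measurable_funB; exact: Lspace1_measurable.
have iB : P.-integrable setT (fun r => (`|f' r - g' r|)%:E).
  exact: integrable_norm (integrableB measurableT if' ig').
rewrite /L1dist Lnorm1 /Rintegral fineK; last exact: integrable_fin_num.
apply: ae_eq_integral => //.
- exact/measurable_EFinP.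
- exact: measurable_int iB.
- by apply: filterS2 ff' gg' => r /= -> ->.
Qed.

Lemma L1dist_sym (R : realType)
    (P : probability (measurableTypeR R) R)
    (f g : LspaceType1 P) : L1dist f g = L1dist g f.
Proof.
by rewrite /L1dist !Lnorm1; apply: eq_integral => r _; rewrite /= distrC.
Qed.

Lemma Lspace1_mean_le (R : realType)
    (P : probability (measurableTypeR R) R)
    (f : LspaceType1 P) (A : set (measurableTypeR R)) : measurable A ->
  (`|\int[P]_(r in A) f r|%:E <= L1norm f)%E.
Proof.
move=> mA; have if' := integrableS measurableT mA (@subsetT _ _) (Lspace1_integrable f).
rewrite EFin_normr_Rintegral // /L1norm Lnorm1.
apply: (le_trans (le_abse_integral P mA (measurable_int _ if'))).
apply: ge0_subset_integral => //.
by apply: measurableT_comp => //; exact: measurable_int (Lspace1_integrable f).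
Qed.

Lemma Lspace1_mean_dist (R : realType)
    (P : probability (measurableTypeR R) R)
    (f g : LspaceType1 P) (A : set (measurableTypeR R)) : measurable A ->
  (`|\int[P]_(r in A) f r - \int[P]_(r in A) g r|%:E <= L1dist f g)%E.
Proof.
move=> mA; have := Lspace1_integrable f; have := Lspace1_integrable g => ig if'.
have iA h : P.-integrable setT h -> P.-integrable A h by exact: integrableS.
have iB := integrableB measurableT if' ig.
rewrite -RintegralB //; [|exact: iA..].
rewrite EFin_normr_Rintegral //; last exact: iA iB.
rewrite /L1dist Lnorm1.
apply: (le_trans (le_abse_integral P mA (measurable_int _ (iA _ iB)))).
apply: ge0_subset_integral => //.
by apply: measurableT_comp => //; exact: measurable_int iB.
Qed.

(** The exceptional null set may depend on t. *)
Definition class_path (R : realType) (P : probability (measurableTypeR R) R)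
    (e : R -> R -> R) (Phi : R -> LspaceType1 P) :=
  forall t, {ae P, forall r, Phi t r = e t r}.

Lemma class_path_exists (R : realType)
    (P : probability (measurableTypeR R) R)
    (C : R) (e : R -> R -> R) : bounded_measurable2 C e ->
  exists Phi : R -> LspaceType1 P, class_path e Phi.
Proof.
move=> be.
have /choice[Phi PhiE] : forall t : R,
    exists g : LspaceType1 P, {ae P, forall r, g r = e t r}.
  by move=> t; apply: Lspace1_lift; exact: row_integrable be.
by exists Phi.
Qed.

(** Dominated convergence: for fixed r, |e s r - e t r| is continuous in s, and the constant C + C
    dominates it and is integrable for a probability. The interval ]t - 1, t + 1[ only serves as a
    neighbourhood of t. *)
Lemma class_path_continuous (R : realType)
    (P : probability (measurableTypeR R) R)
    (C : R) (e : R -> R -> R) (Phi : R -> LspaceType1 P) :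
  bounded_measurable2 C e -> (forall r, continuous (e ^~ r)) ->
  class_path e Phi -> time_continuous Phi.
Proof.
move=> be ce PhiE t t0.
have ie s := @row_integrable R P C e s setT measurableT be.
under eq_fun => s do rewrite (L1distE (ie s) (ie t) (PhiE s) (PhiE t)).
apply: cvg_EFin; first exact: nearW.
apply: cvg_within_filter.
pose d (s r : R) := `|e s r - e t r|.
have id s : P.-integrable setT (EFin \o d s).
  exact: integrable_norm (integrableB measurableT (ie s) (ie t)).
have cd r : continuous (d ^~ r).
  move=> s; apply: cvg_norm; apply: cvgB; [exact: ce|exact: cvg_cst].
have C0 : 0 <= C by case: be => _ /(_ 0 0); apply: le_trans.
have := @continuity_under_integral R _ _ P d setT measurableT (t - 1) (t + 1)
  (fun s _ => id s) _ (fun=> C + C) _ _ t.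
rewrite /= inE /= in_itv /= => H.
have {H} : {for t, continuous (fun s : R => \int[P]_r d s r)}.
  apply: H.
  - by apply: aeW => r _ s _; exact: cd.
  - apply: (@bounded_integrable _ _ _ _ _ (C + C)) => // [|r _].
      exact: prob_lty.
    by rewrite ger0_norm // addr_ge0.
  - move=> s _; apply: aeW => r _; case: be => _ eC.
    by rewrite normr_id (le_trans (ler_normB _ _)) ?lerD.
  - by rewrite ltrBlDr !ltrDl ltr01.
have dtt : \int[P]_r d t r = 0.
  by under eq_Rintegral do rewrite /d subrr normr0; rewrite Rintegral_cst // mul0r.
by rewrite /prop_for /continuous_at dtt.
Qed.

(** * Strong measurability in time *)

(** Rounding t down to the grid of mesh 1 / (n + 1) leaves finitely many values on [0, T], and each
    level set is the trace on [0, T] of a countable union of half-open grid cells. *)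
Lemma grid_simple (R : realType)
    (P : probability (measurableTypeR R) R)
    (T : R) (Phi : R -> LspaceType1 P) (n : nat) :
  simple_on T (fun t => Phi ((Num.truncn (t * n.+1%:R))%:R / n.+1%:R)).
Proof.
have n0 : 0 < n.+1%:R :> R by [].
split=> [|c].
  apply: (@sub_finite_set _ _
    ((fun k : nat => Phi (k%:R / n.+1%:R)) @` `I_(Num.truncn (T * n.+1%:R)).+1)).
    move=> _ [t /= + <-]; rewrite in_itv /= => /andP[t0 tT].
    exists (Num.truncn (t * n.+1%:R)) => //=.
    by rewrite ltnS le_truncn // ler_pM2r.
  exact/finite_image/finite_II.
rewrite (_ : _ `&` _ = `[0, T] `&`
  \bigcup_(k in [set k : nat | Phi (k%:R / n.+1%:R) = c])
    [set` `[k%:R / n.+1%:R, k.+1%:R / n.+1%:R[]); last first.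
  apply/seteqP; split => t /= [].
    rewrite in_itv /= => /andP[t0 tT] tc.
    split; first by rewrite /= ?in_itv /= ?t0.
    exists (Num.truncn (t * n.+1%:R)) => //=.
    rewrite in_itv /= ler_pdivrMr // ltr_pdivlMr //.
    by apply: truncn_itv; rewrite mulr_ge0.
  move=> tT [k /= kc]; rewrite in_itv /= ler_pdivrMr // ltr_pdivlMr //.
  move=> /truncn_def tk.
  by split => //; rewrite tk.
apply: measurableI => //; apply: bigcup_measurable => k _.
exact: measurable_itv.
Qed.

Lemma continuous_strongly_measurable (R : realType)
    (P : probability (measurableTypeR R) R) (T : R) (Phi : R -> LspaceType1 P) :
  time_continuous Phi -> strongly_measurable_on T Phi.
Proof.
move=> cPhi; pose g n (t : R) : R := (Num.truncn (t * n.+1%:R))%:R / n.+1%:R.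
exists (fun n t => Phi (g n t)).
split => [n|t]; first exact: grid_simple.
rewrite in_itv /= => /andP[t0 _].
apply: (cvg_comp _ _ _ (cPhi t t0)).
suff gt : g ^~ t @ \oo --> t.
  move=> B /= Bt.
  (* Continuity of [Phi] is given within [0, +oo[ only; the grid points are nonnegative, so it
     applies to them. *)
  have Bn : \forall n \near \oo, `[0, +oo[%classic (g n t) -> B (g n t) :=
    gt _ Bt.
  suff : \forall n \near \oo, B (g n t) by [].
  apply: filterS Bn => n; apply.
  by rewrite /= in_itv /= andbT; apply: divr_ge0.
apply/cvgrPdist_lt => e e0.
near=> n.
have n0 : 0 < n.+1%:R :> R by [].
have : 0 <= t * n.+1%:R by rewrite mulr_ge0.
move=> /truncn_itv/andP[l u].
rewrite ger0_norm; last by rewrite subr_ge0 ler_pdivrMr.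
(* The rounding error is at most the mesh of the grid. *)
apply: (@le_lt_trans _ _ (n.+1%:R^-1)).
  rewrite lerBlDr -[X in X + _]mul1r -mulrDl ler_pdivlMr //.
  by rewrite addrC natr1 ltW.
near: n; exact: (near_infty_natSinv_lt (PosNum e0)).
Unshelve. all: by end_near. Qed.

Lemma class_path_in_L1T (R : realType)
    (P : probability (measurableTypeR R) R)
    (C T : R) (e : R -> R -> R) (Phi : R -> LspaceType1 P) :
  bounded_measurable2 C e -> (forall r, continuous (e ^~ r)) ->
  class_path e Phi -> in_L1T T Phi.
Proof.
move=> be ce PhiE; split.
  exact/continuous_strongly_measurable/(class_path_continuous be ce PhiE).
apply: (@le_lt_trans _ _ C%:E); last exact: ltry.
apply: ge_ereal_sup => _ [t _ <-].
have C0 : 0 <= C by case: be => _ /(_ 0 0); apply: le_trans.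
rewrite /L1norm Lnorm1.
have := @integral_le_bound _ _ _ P setT (fun r => (Phi t r)%:E) C%:E measurableT.
move=> /(_ (measurable_int _ (Lspace1_integrable (Phi t)))).
rewrite lee_fin => /(_ C0) H; apply: le_trans (H _) _.
  by apply: filterS (PhiE t) => r -> _; case: be => _; rewrite lee_fin.
by rewrite -[leRHS]mule1 lee_wpmul2l ?lee_fin // probability_le1.
Qed.

(** The mean is 1-Lipschitz for [L1dist], so it is the pointwise limit of the means of the simple
    paths. The mean of a simple path is measurable because each preimage is a finite union of level
    sets. *)
Lemma measurable_Lspace1_mean (R : realType)
    (P : probability (measurableTypeR R) R)
    (T : R) (Psi : R -> LspaceType1 P) (A : set (measurableTypeR R)) :
  measurable A -> strongly_measurable_on T Psi ->
  measurable_fun (`[0, T]%classic : set (measurableTypeR R))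
    (fun s => \int[P]_(y in A) Psi s y).
Proof.
move=> mA [S [simS cvgS]].
apply: (@measurable_fun_cvg _ _ _ _ (fun n s => \int[P]_(y in A) S n s y)).
  move=> n; have [finS mS] := simS n => _ Y mY.
  rewrite (_ : _ `&` _ = \bigcup_(c in
      [set c | (S n @` `[0, T]) c /\ Y (\int[P]_(y in A) c y)])
    (`[0, T] `&` S n @^-1` [set c])).
    apply: fin_bigcup_measurable => [|c _]; last exact: mS.
    by apply: sub_finite_set finS => c [].
  apply/seteqP; split => s /=.
    by move=> [sT Ys]; exists (S n s) => //; split => //; exists s.
  by move=> [c [_ Yc] [sT Sc]]; split => //; rewrite /= Sc.
move=> s sT.
have := cvgS s; rewrite inE => /(_ sT) h.
apply/cvgrPdist_le => e e0.
have /fine_cvgP[fin_ /cvgrPdist_le /(_ e e0)] := h.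
apply: filterS2 fin_ => n fn; rewrite /= sub0r normrN ger0_norm => [hn|].
  rewrite -lee_fin; apply: le_trans (Lspace1_mean_dist _ _ mA) _.
  by rewrite L1dist_sym -(fineK fn) lee_fin.
by rewrite fine_ge0 // Lnorm_ge0.
Qed.

Lemma eq_ae_Rintegral (R : realType)
    (P : probability (measurableTypeR R) R)
    (A : set (measurableTypeR R)) (f g : R -> R) : measurable A ->
  measurable_fun A f -> measurable_fun A g ->
  {ae P, forall r, A r -> f r = g r} ->
  \int[P]_(r in A) f r = \int[P]_(r in A) g r.
Proof.
move=> mA mf mg fg; congr fine; apply: ae_eq_integral => //.
- exact/measurable_EFinP.
- exact/measurable_EFinP.
- by apply: filterS fg => r /= fg Ar; rewrite fg.
Qed.

(** * Well-posedness *)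

(** The mean of [Psi] is controlled on [0, T] only; its extension by 0 meets the global bounds and
    measurability required of the argument of [mild_step]. *)
Lemma in_L1T_mean (R : realType)
    (P : probability (measurableTypeR R) R)
    (T : R) (Psi : R -> LspaceType1 P) : in_L1T T Psi ->
  exists (m : R -> R) (B : R), [/\ measurable_fun [set: measurableTypeR R] m,
    (forall s, `|m s| <= B) &
    forall s, s \in `[0, T] -> m s = \int[P]_(y in `]0, +oo[) Psi s y].
Proof.
move=> [smPsi supPsi].
pose B := fine (ereal_sup [set L1norm (Psi t) | t in `[0%R, T]]).
pose mPsi (s : R) := \int[P]_(y in `]0, +oo[) Psi s y.
(* The absolute value keeps the bound valid where the extension is 0. *)
exists (mPsi \_ `[0, T]), `|B|; split.
- by apply/measurable_restrict => //; rewrite setTI; exact: measurable_Lspace1_mean.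
- move=> s; rewrite patchE; case: ifPn => [|_]; last by rewrite normr0.
  rewrite inE => sT; apply: le_trans _ (ler_norm _).
  have le := ereal_sup_ubound (ex_intro2 _ _ s sT erefl :
    [set L1norm (Psi t) | t in `[0%R, T]] (L1norm (Psi s))).
  rewrite -lee_fin /B fineK; first by apply: le_trans le; exact: Lspace1_mean_le.
  by rewrite ge0_fin_numE //; apply: le_trans le; exact: Lnorm_ge0.
- by move=> s sT; rewrite patchE mem_set.
Qed.

(** On [0, T] the means of [Psi] and of [e] are fixed points of the same contraction, hence equal.
    [Psi] and [e] are then both given by the same right-hand side. *)
Lemma mild_equation_unique (R : realType)
    (P : probability (measurableTypeR R) R)
    (a b c Q C T : R) (q e : R -> R -> R) (Phi Psi : R -> LspaceType1 P) :
  P `]0, +oo[%classic = 1%E -> 0 <= b < a -> bounded_measurable2 Q q ->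
  bounded_measurable2 C e ->
  (forall t r, e t r = mild_step a b c q (prob_mean P e) t r) ->
  class_path e Phi -> in_L1T T Psi ->
  (forall t, t \in `[0, T] -> {ae P, forall r : R, 0 < r ->
    Psi t r = mild_step a b c q (fun s => \int[P]_(y in `]0, +oo[) Psi s y) t r}) ->
  forall t, t \in `[0, T] -> Psi t = Phi t.
Proof.
move=> P1 /andP[b0 ba] bq be eE PhiE PsiL1 PsiE.
have a0 : 0 < a by apply: le_lt_trans ba.
have C0 : 0 <= C by case: be => _ /(_ 0 0); apply: le_trans.
have [m1 [B [mm1 m1B m1E]]] := in_L1T_mean PsiL1.
have B0 : 0 <= B by apply: le_trans (m1B 0).
pose mPsi (s : R) := \int[P]_(y in `]0, +oo[) Psi s y.
have stepE t r : t \in `[0, T] ->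
    mild_step a b c q mPsi t r = mild_step a b c q m1 t r.
  rewrite in_itv /= => /andP[t0 tT]; congr (c + _).
  apply: eq_duhamel => s /andP[s0 st].
  by rewrite m1E // in_itv /= s0 (le_trans st).
have {}PsiE t : t \in `[0, T] ->
    {ae P, forall r : R, 0 < r -> Psi t r = mild_step a b c q m1 t r}.
  move=> tT; apply: ae_mono (PsiE t tT) => r + r0 => /(_ r0) ->.
  exact: stepE.
pose m2 := prob_mean P e.
have mm2 : measurable_fun [set: measurableTypeR R] m2 :=
  measurable_prob_mean P be.
have m2C s : `|m2 s| <= C := prob_mean_le P s be.
have bF := bounded_mild_step c a0 b0 bq mm1 m1B.
(* Averaging the equation over r > 0 closes it on the mean. *)
have m1_fix t : t \in `[0, T] -> m1 t = prob_mean P (mild_step a b c q m1) t.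
  move=> tT; rewrite m1E //; apply: eq_ae_Rintegral => //.
  - by apply: measurable_funTS; exact: Lspace1_measurable.
  - by apply: measurable_funTS; apply: measurable2_row; case: bF.
  - by apply: ae_mono (PsiE t tT) => r h; rewrite /= in_itv /= andbT => /h.
have dist n t : t \in `[0, T] -> `|m1 t - m2 t| <= (b / a) ^+ n * (B + C).
  elim: n t => [|n IH] t tT.
    rewrite expr0 mul1r; apply: (le_trans (ler_normB _ _)); exact: lerD.
  have D0 : 0 <= (b / a) ^+ n * (B + C).
    by rewrite mulr_ge0 ?addr_ge0 // exprn_ge0 // divr_ge0 // ltW.
  rewrite m1_fix // /m2; apply: (@prob_mean_dist _ P _ _ _ _ _ t bF be).
    by rewrite exprS -mulrA mulr_ge0 // divr_ge0 // ltW.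
  move=> r; rewrite eE exprS -mulrA.
  apply: (mild_step_dist _ _ a0 b0 bq mm1 m1B mm2 m2C D0) => s /andP[s0 st].
  (* The induction hypothesis is restricted to [0, T], which suffices since the step at t only looks
     at s <= t. *)
  by apply: IH; move: tT; rewrite !in_itv /= s0 => /andP[_]; exact: le_trans.
have m12 t : t \in `[0, T] -> m1 t = m2 t.
  move=> tT; apply/eqP; rewrite -subr_eq0; apply/eqP.
  apply: (@geometric_bound_eq0 _ (b / a) (B + C)); last by move=> n; exact: dist.
  by rewrite divr_ge0 ?(ltW a0) // ltr_pdivrMr // mul1r.
move=> t tT; apply: Lspace1_ext.
have PsiE' : {ae P, forall r : R, Psi t r = mild_step a b c q m1 t r}.
  by apply: ae_mono2 (ae_gt0 P1) (PsiE t tT) => r r0 /(_ r0).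
apply: ae_mono2 PsiE' (PhiE t) => r -> ->.
rewrite eE; congr (c + _); apply: eq_duhamel => s /andP[s0 st].
by rewrite m12 //; move: tT; rewrite !in_itv /= s0 => /andP[_]; exact: le_trans.
Qed.

(** [Phi] is built at all times at once, so one path serves every T. The function [e] is returned
    along with it because equation (ii) calls for a jointly measurable version of the first
    solution, and a bounded one to control its square. *)
Lemma mild_equation_wellposed (R : realType)
    (P : probability (measurableTypeR R) R)
    (a b c Q : R) (q : R -> R -> R) :
  P `]0, +oo[%classic = 1%E -> 0 <= b < a -> bounded_measurable2 Q q ->
  exists C e (Phi : R -> LspaceType1 P),
    [/\ bounded_measurable2 C e,
        forall t r, e t r = mild_step a b c q (prob_mean P e) t r,
        class_path e Phi,
        time_continuous Phi /\ forall T, in_L1T T Phi &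
        forall T Psi, in_L1T T Psi ->
          (forall t, t \in `[0, T] -> {ae P, forall r : R, 0 < r -> Psi t r =
             mild_step a b c q (fun s => \int[P]_(y in `]0, +oo[) Psi s y) t r}) ->
          forall t, t \in `[0, T] -> Psi t = Phi t].
Proof.
move=> P1 ba bq.
have [C [e be eE]] := mild_equation_exists P c ba bq.
have [Phi PhiE] := class_path_exists P be.
have ce r : continuous (e ^~ r).
  have [b0 ab] := andP ba.
  have a0 : 0 < a by apply: le_lt_trans ab.
  have cs := continuous_duhamel (r := r) a0 (bounded_source b0 bq
    (measurable_prob_mean P be) (fun s => prob_mean_le P s be)).
  rewrite (_ : e ^~ r = fun t => mild_step a b c q (prob_mean P e) t r); last first.
    by apply/funext => t; rewrite eE.
  by move=> t; apply: cvgD; [exact: cvg_cst|exact: cs].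
exists C, e, Phi; split => //.
- split; first exact: class_path_continuous be ce PhiE.
  by move=> T; exact: class_path_in_L1T be ce PhiE.
- move=> T Psi iPsi PsiE.
  exact: mild_equation_unique P1 ba bq be eE PhiE iPsi PsiE.
Qed.

(** * From [mild_step] back to the two equations *)

(** The constant 1 and the source - a combine into exp(- a r t) by [duhamel_cst]. Linearity of the
    integral is applied to the globally bounded [m1], and causality then restores [m]. *)
Lemma mild_step_expR (R : realType) (a b T t r : R) (m m1 : R -> R) (B : R) :
  0 < a -> measurable_fun [set: measurableTypeR R] m1 ->
  (forall s, `|m1 s| <= B) -> (forall s, s \in `[0, T] -> m1 s = m s) ->
  t \in `[0, T] -> 0 < r ->
  mild_step a b 1 (fun _ _ => - a) m t r = expR (- a * r * t) +
    b * r * \int[lebesgue_measure]_(s in `[0, t])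
      (expR (- a * r * (t - s)) * m s).
Proof.
move=> a0 mm1 m1B m1E; rewrite in_itv /= => /andP[t0 tT] r0.
have m1m s : 0 <= s <= t -> m1 s = m s.
  by move=> /andP[s0 st]; apply: m1E; rewrite in_itv /= s0 (le_trans st).
have bm1 : bounded_measurable2 B (fun s _ => m1 s).
  by split => [|s x] //; exact: (measurableT_comp mm1 measurable_fst).
have bbm1 : bounded_measurable2 (`|b| * B) (fun s _ => b * m1 s).
  split => [|s x]; last by rewrite normrM ler_wpM2l.
  by apply: measurable_funM => //; case: bm1.
have ba : bounded_measurable2 a (fun _ _ => a).
  by split => [|s x]; [exact: measurable_cst|rewrite gtr0_norm].
rewrite /mild_step (@eq_duhamel _ _ _ (fun s _ => b * m1 s - a)); last first.
  by move=> s st; rewrite m1m // addrC.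
rewrite (duhamelB t r a0 bbm1 ba) duhamel_cst // divff ?gt_eqF // mul1r.
have -> : duhamel a (fun s _ => b * m1 s) t r =
    b * duhamel a (fun s _ => m1 s) t r.
  rewrite /duhamel [RHS]mulrCA; congr (_ * _).
  rewrite -RintegralZl //; last exact: duhamel_integrable bm1.
  by apply: eq_Rintegral => s _; rewrite mulrCA.
rewrite (@eq_duhamel _ a (fun s _ => m1 s) (fun s _ => m s) t r m1m).
rewrite /duhamel max_l ?(ltW r0) //.
by ring.
Qed.

(** Fubini: the set where e and e' differ has P-null sections at each time of [0, T], so it is null
    for the product measure, and its sections at P-almost every r are Lebesgue-null. *)
Lemma measurable_version_ae_eq (R : realType)
    (P : probability (measurableTypeR R) R)
    (T : R) (Phi : R -> LspaceType1 P) (e e' : R -> R -> R) :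
  measurable_version T Phi e -> measurable_version T Phi e' ->
  {ae P, forall r : R, {ae @lebesgue_measure R, forall s : R,
    s \in `[0, T] -> e s r = e' s r}}.
Proof.
move=> [me eE] [me' e'E].
pose D : set (measurableTypeR R * measurableTypeR R) := [set` `[0, T]] `*` setT.
have mD : measurable D by exact: measurableX.
(* Both versions are measurable on [0, T] * R only, so the disagreement set is cut down to that
   strip. *)
pose N := D `&` (fun p => e p.1 p.2 - e' p.1 p.2) @^-1` (~` [set 0]).
have mN : measurable N.
  by apply: (measurable_funB me me') => //; exact: measurableC.
pose g (p : measurableTypeR R * measurableTypeR R) : \bar R := (\1_N p)%:E.
have mg : measurable_fun setT g.
  by apply/measurable_EFinP; exact: measurable_indic.
have g0 p : (0 <= g p)%E by rewrite lee_fin.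
have gE p : (0 < g p)%E -> p.1 \in `[0, T] /\ e p.1 p.2 != e' p.1 p.2.
  rewrite lte_fin /g indicE.
  case: (boolP (p \in N)) => [+ _|_]; last by rewrite ltxx.
  by rewrite inE => -[[? _]] /= /eqP; rewrite subr_eq0.
have := fubini_tonelli (m1 := @lebesgue_measure R) (m2 := P) g mg g0.
rewrite integral0_eq; last first.
  move=> s _.
  have [sT|sT] := boolP (s \in `[0, T]); last first.
    apply: integral0_eq => r _; apply/eqP; rewrite eq_le g0 andbT leNgt.
    apply/negP => g_gt0; have [/= sT' _] := gE (s, r) g_gt0.
    by rewrite sT' in sT.
  rewrite (@ae_eq_integral _ _ _ P setT (cst 0%E)) ?integral0 //.
    exact: (measurableT_comp mg (measurable_pair1 s)).
  apply: ae_mono2 (eE s sT) (e'E s sT) => r h h' _.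
  apply/eqP; rewrite eq_le g0 andbT leNgt.
  by apply/negP => g_gt0; have [/= _] := gE (s, r) g_gt0; rewrite h h' eqxx.
move=> /esym G0.
have mG : measurable_fun setT
    (fun r : measurableTypeR R => \int[@lebesgue_measure R]_s g (s, r))%E.
  exact: (measurable_fun_fubini_tonelli_G g).
(* A nonnegative function with zero integral vanishes almost everywhere: used first in r, then in s
   for each good r. *)
have /(ae_eq_integral_abs P measurableT mG) :
    (\int[P]_r `|\int[@lebesgue_measure R]_s g (s, r)| = 0)%E.
  rewrite -[RHS]G0; apply: eq_integral => r _.
  by rewrite gee0_abs // integral_ge0.
apply: ae_mono => r /(_ I) /= Gr0.
have mgr : measurable_fun setT (fun s : measurableTypeR R => g (s, r)).
  exact: (measurableT_comp mg (measurable_pair2 r)).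
have : (\int[@lebesgue_measure R]_s `|g (s, r)| = 0)%E.
  by rewrite -[RHS]Gr0; apply: eq_integral => s _; rewrite gee0_abs.
move=> /(ae_eq_integral_abs _ measurableT mgr).
apply: ae_mono => s /(_ I) /= gs0 sT.
apply/eqP; rewrite -subr_eq0; apply: contraT => ne.
suff : g (s, r) = 1%E by rewrite gs0 => /eqP; rewrite eq_sym onee_eq0.
rewrite /g indicE mem_set //; split => //=.
by apply/eqP.
Qed.

(** For a good r the two integrands agree at almost every s in [0, T]. One null set of r works for
    all t, since it comes from comparing the versions on the whole of [0, T]. *)
Lemma duhamel_version (R : realType)
    (P : probability (measurableTypeR R) R)
    (a b w M2 T : R) (Phi : R -> LspaceType1 P) (e e' : R -> R -> R)
    (m v : R -> R) :
  measurable_version T Phi e -> measurable_version T Phi e' ->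
  measurable_fun (`[0, T]%classic : set (measurableTypeR R)) m ->
  measurable_fun (`[0, T]%classic : set (measurableTypeR R)) v ->
  {ae P, forall r : R, forall t, t \in `[0, T] ->
    duhamel a (fun s r => M2 * (w * e s r ^+ 2 + v s) + b * m s) t r =
    duhamel a (fun s r => M2 * (w * e' s r ^+ 2 + v s) + b * m s) t r}.
Proof.
move=> ve ve' mm mv.
apply: ae_mono (measurable_version_ae_eq ve ve') => r ee' t tT.
have tsub : `[0, t]%classic `<=` `[0, T]%classic.
  move=> s /=; move: tT; rewrite !in_itv /= => /andP[_ tT].
  by move=> /andP[-> /le_trans]; apply.
have mslice k : measurable_version T Phi k ->
    measurable_fun (`[0, t]%classic : set (measurableTypeR R))
      (fun s => expR (- a * Num.max r 0 * (t - s)) *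
        (M2 * (w * k s r ^+ 2 + v s) + b * m s)).
  move=> [mk _]; apply: measurable_funM; first exact: measurable_expR_affine.
  apply: measurable_funD; last first.
    by apply: measurable_funM => //; exact: measurable_funS mm.
  apply: measurable_funM => //; apply: measurable_funD; last exact: measurable_funS mv.
  apply: measurable_funM => //; apply: measurable_funX.
  apply: (@measurable_funS _ _ _ _ `[0, T]%classic) => //.
  have mD : measurable ([set` `[0, T]] `*` setT :
      set (measurableTypeR R * measurableTypeR R)).
    exact: measurableX.
  apply: (measurable_comp (g := fun s : measurableTypeR R =>
    (s, r) : measurableTypeR R * measurableTypeR R) mD _ mk).
  - by move=> _ [s sT <-].
  - apply: measurable_funTS; exact: measurable_pair2.
congr (_ * fine _); apply: ae_eq_integral => //.
- by apply/measurable_EFinP; exact: mslice.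
- by apply/measurable_EFinP; exact: mslice.
- by apply: ae_mono ee' => s h st /=; rewrite h //; exact: tsub.
Qed.

Lemma measurable_version_class_path (R : realType)
    (P : probability (measurableTypeR R) R) (C T : R) (e : R -> R -> R)
    (Phi Psi : R -> LspaceType1 P) : bounded_measurable2 C e ->
  class_path e Phi -> (forall t, t \in `[0, T] -> Psi t = Phi t) ->
  measurable_version T Psi e.
Proof.
move=> [me _] PhiE PsiE; split; first exact: measurable_funTS.
by move=> t tT; rewrite PsiE //; apply: filterS (PhiE t) => r ->.
Qed.

Theorem proposition2 (R : realType) (w : R)
    (P : probability (measurableTypeR R) R)
    (nu : {measure set (measurableTypeR R) -> \bar R})
    (sigma : R -> R) (M1 M2 : R)
    (hw : 0 <= w <= 1)
    (hP : P `]0, +oo[%classic = 1%E)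
    (hPinv : (\int[P]_(r in `]0%R, +oo[) (r^-1)%:E < +oo)%E)
    (hsigma : measurable_fun (`]0, +oo[ : set (measurableTypeR R)) sigma)
    (hsigma_gt0 : forall z, 0 < z -> 0 < sigma z)
    (hnu : has_density nu sigma)
    (hlevy : levy_measure nu)
    (hM1 : M1%:E = (\int[nu]_(z in `]0%R, +oo[) z%:E)%E)
    (hM1_01 : 0 < M1 < 1)
    (hM2 : M2%:E = (\int[nu]_(z in `]0%R, +oo[) (z ^+ 2)%:E)%E) :
  (exists E1 : R -> LspaceType1 P,
     solution_for_all_T (mild_solution1 w M1) E1 /\
     unique_for_all_T (mild_solution1 w M1) E1 /\
     time_continuous E1) /\
  (forall E1 : R -> LspaceType1 P,
     solution_for_all_T (mild_solution1 w M1) E1 ->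
     exists E2 : R -> LspaceType1 P,
       solution_for_all_T (mild_solution2 w M1 M2 E1) E2 /\
       unique_for_all_T (mild_solution2 w M1 M2 E1) E2 /\
       time_continuous E2).
Proof.
have [/andP[w0 w1] /andP[M10 M11]] := (hw, hM1_01).
set a := 1 - w * M1; set b := (1 - w) * M1.
(* Here a - b = 1 - M1, so the contraction condition is M1 < 1. *)
have ba : 0 <= b < a.
  rewrite /a /b mulr_ge0 ?subr_ge0 ?(ltW M10) //=.
  by rewrite mulrBl mul1r ltrD2r.
have a0 : 0 < a by have /andP[] := ba; exact: le_lt_trans.
have bq1 : bounded_measurable2 a (fun _ _ => - a).
  by split => [|s r]; [exact: measurable_cst|rewrite normrN gtr0_norm].
have [C1 [e1 [Phi1 [be1 e1E Phi1E [cPhi1 iPhi1] uPhi1]]]] :=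
  mild_equation_wellposed 1 hP ba bq1.
have mean1 (C : R) e (Phi : R -> LspaceType1 P) s : bounded_measurable2 C e ->
    class_path e Phi -> \int[P]_(y in `]0, +oo[) Phi s y = prob_mean P e s.
  move=> be PhiE; apply: eq_ae_Rintegral => //.
  - by apply: measurable_funTS; exact: Lspace1_measurable.
  - by apply: measurable_funTS; apply: measurable2_row; case: be.
  - by apply: filterS (PhiE s) => r -> _.
have solE1 (T : R) (Psi : R -> LspaceType1 P) t : in_L1T T Psi ->
    t \in `[0, T] -> forall r, 0 < r ->
    mild_step a b 1 (fun _ _ => - a)
      (fun s => \int[P]_(y in `]0, +oo[) Psi s y) t r =
    expR (- a * r * t) + b * r * \int[lebesgue_measure]_(s in `[0, t])
      (expR (- a * r * (t - s)) * \int[P]_(y in `]0, +oo[) Psi s y).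
  move=> iPsi tT r r0; have [m1 [B [mm1 m1B m1E]]] := in_L1T_mean iPsi.
  exact: mild_step_expR a0 mm1 m1B m1E tT r0.
have uE1 : unique_for_all_T (mild_solution1 w M1) Phi1.
  move=> T T0 Psi iPsi sPsi; apply: uPhi1 => // t tT.
  by apply: ae_mono (sPsi t tT) => r h r0; rewrite (solE1 T) // h.
split.
  exists Phi1; split; last by split.
  move=> T T0; split => // t tT; apply: ae_mono (Phi1E t) => r -> r0.
  rewrite -(solE1 T) // e1E; congr (mild_step a b 1 _ _ t r).
  by apply/funext => s; rewrite (mean1 _ _ _ _ be1 Phi1E).
move=> E1 sE1.
(* Part (ii) starts from an arbitrary solution; uniqueness in (i) identifies it with [Phi1], so that
   [e1] represents it. The horizon t + 1 is positive even at t = 0. *)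
have E1E t : 0 <= t -> E1 t = Phi1 t.
  move=> t0; have T0 : 0 < t + 1 by rewrite ltr_wpDl.
  have [iE1 mE1] := sE1 _ T0; apply: (uE1 _ T0) => //.
  by rewrite in_itv /= t0 lerDl ler01.
have E1T (T : R) t : t \in `[0, T] -> E1 t = Phi1 t.
  by rewrite in_itv /= => /andP[t0 _]; exact: E1E.
(* Membership in L^1 alone would not control the squares; the uniform bound on [e1] makes them a
   bounded source. *)
pose e1sq (s r : R) := e1 s r ^+ 2.
have be1sq : bounded_measurable2 (C1 ^+ 2) e1sq.
  case: be1 => me1 e1C; split => [|s r]; first exact: measurable_funX.
  by rewrite /e1sq normrX lerXn2r ?nnegrE // (le_trans _ (e1C 0 0)).
pose v (s : R) := (1 - w) * prob_mean P e1sq s.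
pose q2 (s r : R) := M2 * (w * e1 s r ^+ 2 + v s).
have mv : measurable_fun [set: measurableTypeR R] v.
  by apply: measurable_funM => //; exact: measurable_prob_mean be1sq.
have bq2 : bounded_measurable2
    (`|M2| * (`|w| * C1 ^+ 2 + `|1 - w| * C1 ^+ 2)) q2.
  case: (be1sq) => me1 e1C; split => [|s r].
    apply: measurable_funM => //; apply: measurable_funD.
      exact: measurable_funM.
    exact: (measurableT_comp mv measurable_fst).
  rewrite normrM ler_wpM2l //; apply: (le_trans (ler_normD _ _)).
  apply: lerD; first by rewrite normrM ler_wpM2l //; exact: e1C.
  by rewrite /v normrM ler_wpM2l //; exact: prob_mean_le be1sq.
have mean1sq s : 0 <= s ->
    \int[P]_(y in `]0, +oo[) (E1 s y ^+ 2) = prob_mean P e1sq s.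
  move=> s0; apply: eq_ae_Rintegral => //.
  - by apply: measurable_funTS; apply: measurable_funX; exact: Lspace1_measurable.
  - by apply: measurable_funTS; apply: measurable2_row; case: be1sq.
  - by rewrite E1E //; apply: filterS (Phi1E s) => r -> _.
(* Stated for any version [e], since each solution of (ii) comes with its own. *)
have rhsE (e : R -> R -> R) (Psi : R -> LspaceType1 P) t r : 0 < r ->
    r * \int[lebesgue_measure]_(s in `[0, t])
      (expR (- a * r * (t - s)) * (b * (\int[P]_(y in `]0, +oo[) Psi s y)
          + M2 * (w * e s r ^+ 2
                  + (1 - w) * \int[P]_(y in `]0, +oo[) (E1 s y ^+ 2)))) =
    duhamel a (fun s r => M2 * (w * e s r ^+ 2 + v s) +
      b * \int[P]_(y in `]0, +oo[) Psi s y) t r.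
  move=> r0; rewrite /duhamel max_l ?(ltW r0) //; congr (_ * _).
  apply: eq_Rintegral => s; rewrite inE /= in_itv /= => /andP[s0 _].
  by rewrite mean1sq // [b * _ + _]addrC.
have [C2 [e2 [Phi2 [be2 e2E Phi2E [cPhi2 iPhi2] uPhi2]]]] :=
  mild_equation_wellposed 0 hP ba bq2.
exists Phi2; split; [|split] => //.
- move=> T T0; split => //; exists e1.
    exact: measurable_version_class_path be1 Phi1E (E1T T).
  move=> t tT; apply: ae_mono (Phi2E t) => r -> r0.
  rewrite rhsE // e2E /mild_step add0r; apply: eq_duhamel => s _.
  by rewrite (mean1 _ _ _ _ be2 Phi2E).
(* The competitor uses an unknown version [e]; [duhamel_version] trades it for [e1] at almost every
   r, after which the uniqueness for the source [q2] applies. *)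
- move=> T T0 Psi iPsi [e ve PsiE]; apply: uPhi2 => // t tT.
  have ve1 := measurable_version_class_path be1 Phi1E (E1T T).
  have mPsi : measurable_fun (`[0, T]%classic : set (measurableTypeR R))
      (fun s => \int[P]_(y in `]0, +oo[) Psi s y).
    by apply: measurable_Lspace1_mean => //; case: iPsi.
  have eqd := duhamel_version a b w M2 ve ve1 mPsi (measurable_funTS mv).
  apply: ae_mono2 (PsiE t tT) eqd => r h d r0.
  by rewrite h // rhsE // d // /mild_step add0r.
Qed.
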